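(* Let the winning probability at each coup be $p\in[0,1]$. For any $(-2,1)$-list system, with largest bet size $B^\star$, the following holds: 1. If $p>\frac12$, then $\mathbb{E}[B^\star]<\infty$. 2. If $\frac13<p<\frac12$, then $\mathbb{E}[B^\star]=\infty$. 3. If $p\le\frac13$ and there are constants $c_1>0$ and $c_2\in\mathbb{R}$ such that, almost surely, $B_n\ge c_1 l_{n-1}+c_2$ for every coup $n$, then $\mathbb{E}[B^\star]=\infty$.
   Context: A gambler plays a sequence of independent coups, each won with probability $p$ and lost with probability $1-p$. A $(-2,1)$-list system consists of a target sequence $\{T_n\}_{n\ge0}$, a bet sequence $\{B_n\}_{n\ge1}$ and a length sequence $\{l_n\}_{n\ge0}$ evolving as follows. (1) Initially $T_0>0$ is a (deterministic) real number and $l_0\in\{1,2,\dots\}$. (2) At the $n$-th coup the system makes a bet $B_n\in[0,T_{n-1}]$, which may depend on the entire history (i.e. on the initial data and the outcomes of coups $1,\dots,n-1$). Then $T_n=T_{n-1}-B_n$ and $l_n=(l_{n-1}-2)_+$ if the coup is won, and $T_n=T_{n-1}+B_n$ and $l_n=l_{n-1}+1$ if the coup is lost, where $x_+=\max\{x,0\}$. (3) Termination condition: let $N=\inf\{n: l_n=0\}$ (possibly $\infty$). The system must satisfy $T_n=l_n=0$ for all $n\ge N$ and $B_n=0$ for all $n>N$. (So the evolution rule in (2) applies up to coup $N$.) The largest bet size is $B^\star=\max_{1\le n\le N}B_n$ if $N<\infty$, and $B^\star=\sup_{n\ge1}B_n$ if $N=\infty$. *)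

(* Defs.v *)
From HB Require Import structures.
From mathcomp Require Import all_boot all_order all_algebra.
From mathcomp Require Import all_classical all_reals all_analysis.

Set Implicit Arguments.
Unset Strict Implicit.
Unset Printing Implicit Defensive.

Import Order.TTheory GRing.Theory Num.Theory.

Local Open Scope classical_set_scope.
Local Open Scope ring_scope.

Definition mutually_independent (d d' : measure_display)
    (Omega : measurableType d) (S : measurableType d') (R : realType)
    (P : probability Omega R) (X : nat -> {RV P >-> S}) : Prop :=
  forall (A : nat -> set S), (forall i, measurable (A i)) ->
  forall s : seq nat, uniq s ->
    P (\big[setI/setT]_(i <- s) (X i @^-1` A i)) =
    (\prod_(i <- s) P (X i @^-1` A i))%E.

(* Coups are numbered from 1: [X n] is the outcome of coup [n >= 1], with
   [true] for a win, and [X 0] is never used. *)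
Record independent_coups (d : measure_display) (Omega : measurableType d)
    (R : realType) (P : probability Omega R) (p : R)
    (X : nat -> {RV P >-> bool}) : Prop := IndependentCoups {
  coup_win : forall n, P (X n.+1 @^-1` [set true]) = p%:E;
  coup_indep : mutually_independent (fun n => X n.+1)
}.

Section ListSystem.
Variables (d : measure_display) (Omega : measurableType d) (R : realType).

(* N = inf {n : l_n = 0}; it is +oo when the set is empty. *)
Definition duration (l : nat -> Omega -> nat) (w : Omega) : \bar R :=
  ereal_inf [set (n%:R)%:E | n in [set n | l n w = 0%N]].

(* The subtraction [l n w - 2] on [nat] is truncated, i.e. (l_n - 2)_+.
   [B 0] is never used. *)
Record list_system (X : nat -> Omega -> bool) (t0 : R) (l0 : nat)
    (T B : nat -> Omega -> R) (l : nat -> Omega -> nat) : Prop := ListSystem {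
  target0_gt0 : 0 < t0;
  length0_gt0 : (0 < l0)%N;
  target0E : forall w, T 0%N w = t0;
  length0E : forall w, l 0%N w = l0;
  bet_history : exists beta : seq bool -> R, forall n w,
    B n.+1 w = beta [seq X i w | i <- iota 1 n];
  bet_range : forall n w, 0 <= B n.+1 w <= T n w;
  coup_won : forall n w, ((n.+1%:R)%:E <= duration l w)%E -> X n.+1 w = true ->
    T n.+1 w = T n w - B n.+1 w /\ l n.+1 w = (l n w - 2)%N;
  coup_lost : forall n w, ((n.+1%:R)%:E <= duration l w)%E -> X n.+1 w = false ->
    T n.+1 w = T n w + B n.+1 w /\ l n.+1 w = (l n w + 1)%N;
  terminated : forall n w, (duration l w <= (n%:R)%:E)%E ->
    T n w = 0 /\ l n w = 0%N;
  no_bet_after : forall n w, (duration l w < (n%:R)%:E)%E -> B n w = 0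
}.

(* The supremum over the integers 1 <= n <= N: for N < +oo it is taken over a
   finite nonempty set and is a maximum; for N = +oo it is sup_{n >= 1} B_n. *)
Definition largest_bet (B : nat -> Omega -> R) (l : nat -> Omega -> nat)
    (w : Omega) : \bar R :=
  ereal_sup [set (B n w)%:E |
    n in [set n | (1 <= n)%N /\ ((n%:R)%:E <= duration l w)%E]].

End ListSystem.

(* Main.v *)
(* For p > 1/2, T_n + (2p - 1)(B_1 + ... + B_n) is a martingale with T_n >= 0,
   so the expected sum of all bets, hence E[B*], is at most t0 / (2p - 1).

   For p < 1/2, as long as no bet exceeds m = (1 - 2p) K, the process
   K / (K + T_n) is a supermartingale that equals 1 once the list is finished;
   hence no bet exceeds m and the list is finished with probability at most
   K / (K + t0).  If moreover the system almost surely either finishes or makes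
   a bet larger than m, then P(B* > m) >= t0 / (K + t0), which is of order 1/m,
   so that E[B*] = +oo by divergence of the harmonic series.  For p > 1/3 the
   list finishes because its length has negative drift.  For p <= 1/3, bets at
   most m force l_n <= L for some L, and l_n^2 has drift at least 1, so the
   length cannot stay between 1 and L forever. *)
Require Import Defs.
From HB Require Import structures.
From mathcomp Require Import all_boot all_order all_algebra.
From mathcomp Require Import all_classical all_reals all_analysis.
From mathcomp Require Import measurable_realfun.
From mathcomp Require Import ring lra zify.

Set Implicit Arguments.
Unset Strict Implicit.
Unset Printing Implicit Defensive.

Import Order.TTheory GRing.Theory Num.Theory.

Local Open Scope classical_set_scope.
Local Open Scope ring_scope.

(** * Weighted means over finite words of outcomes *)

Section Words.
Variables (R : realType) (p : R).

Fixpoint words (n : nat) : seq (seq bool) :=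
  if n is m.+1 then map (cons true) (words m) ++ map (cons false) (words m)
  else [:: [::]].

Lemma mem_words n r : (r \in words n) = (size r == n).
Proof.
elim: n r => [|n IH] [|b r] //=; rewrite ?inE // mem_cat.
  by apply/negbTE; rewrite negb_or; apply/andP; split; apply/mapP => -[].
have inj b' : injective (cons b' : seq bool -> seq bool) by move=> ? ? [].
case: b; rewrite (mem_map (inj _)) IH eqSS.
  by rewrite [X in _ || X](_ : _ = false) ?orbF//; apply/negbTE/mapP => -[].
by rewrite [X in X || _](_ : _ = false) //; apply/negbTE/mapP => -[].
Qed.

Lemma uniq_words n : uniq (words n).
Proof.
elim: n => //= n IH.
rewrite cat_uniq !map_inj_uniq ?IH /=; try by move=> ? ? [].
by rewrite andbT; apply/hasPn => _ /mapP[r _ ->]; apply/mapP => -[].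
Qed.

Definition coin (b : bool) : R := if b then p else 1 - p.

Definition weight (r : seq bool) : R := \prod_(b <- r) coin b.

Definition mean (n : nat) (F : seq bool -> R) : R :=
  \sum_(r <- words n) weight r * F r.

Lemma mean0 F : mean 0 F = F [::].
Proof. by rewrite /mean big_seq1 /weight big_nil mul1r. Qed.

(** The added letter is the head of the word, which stands for the latest coup, so this is
    conditioning on the first [n] coups. *)
Lemma meanS n F :
  mean n.+1 F = mean n (fun r => p * F (true :: r) + (1 - p) * F (false :: r)).
Proof.
rewrite /mean /= big_cat /= !big_map -big_split /=; apply: eq_bigr => r _.
by rewrite /weight !big_cons /coin; ring.
Qed.

Lemma meanD n F G : mean n (fun r => F r + G r) = mean n F + mean n G.
Proof. by rewrite /mean -big_split; apply: eq_bigr => r _; rewrite mulrDr. Qed.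

Lemma meanZr n F a : mean n (fun r => F r * a) = mean n F * a.
Proof. by rewrite /mean mulr_suml; apply: eq_bigr => r _; rewrite mulrA. Qed.

Lemma mean_sum n I (s : seq I) (F : I -> seq bool -> R) :
  mean n (fun r => \sum_(i <- s) F i r) = \sum_(i <- s) mean n (F i).
Proof.
by rewrite /mean exchange_big; apply: eq_bigr => r _; rewrite mulr_sumr.
Qed.

Hypothesis p01 : 0 <= p <= 1.

Lemma coin_ge0 b : 0 <= coin b.
Proof. by case: b; rewrite /coin; move: p01 => /andP[? ?]; lra. Qed.

Lemma weight_ge0 r : 0 <= weight r.
Proof. by apply: prodr_ge0 => b _; exact: coin_ge0. Qed.

Lemma ler_mean n F G : (forall r, F r <= G r) -> mean n F <= mean n G.
Proof. by move=> FG; apply: ler_sum => r _; rewrite ler_wpM2l// weight_ge0. Qed.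

(** With words read latest coup first, [F] of the history is a supermartingale. *)
Definition superharmonic (F : seq bool -> R) :=
  forall r, p * F (true :: r) + (1 - p) * F (false :: r) <= F r.

Lemma mean_superharmonic n F : superharmonic F -> mean n F <= F [::].
Proof.
move=> HF; elim: n => [|n IH]; first by rewrite mean0.
apply: le_trans IH; rewrite meanS; apply: ler_sum => r _.
by apply: ler_wpM2l (HF r); exact: weight_ge0.
Qed.

End Words.

(** * Law of the first n outcomes on the probability space *)

Section RandomHistories.
Variables (d : measure_display) (Omega : measurableType d) (R : realType).
Variables (P : probability Omega R) (p : R) (X : nat -> {RV P >-> bool}).
Hypothesis (HX : independent_coups p X).

(* Most recent coup first. *)
Fixpoint history (n : nat) (w : Omega) : seq bool :=
  if n is m.+1 then X m.+1 w :: history m w else [::].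

Lemma size_history n w : size (history n w) = n.
Proof. by elim: n => //= n ->. Qed.

Lemma rev_history n w : rev (history n w) = [seq X i w | i <- iota 1 n].
Proof.
elim: n => // n IH.
by rewrite -[in RHS](addn1 n) iotaD map_cat -IH add1n cats1 -rev_cons.
Qed.

(** Puts the event in the product form to which independence applies. *)
Lemma history_eq n (a : nat -> bool) :
  [set w | history n w = rev (mkseq a n)] =
  \big[setI/setT]_(i <- iota 0 n) (X i.+1 @^-1` [set a i]).
Proof.
elim: n => [|n IH]; first by rewrite big_nil; apply/seteqP; split.
rewrite -[in RHS](addn1 n) iotaD big_cat /= big_seq1 add0n -IH.
rewrite mkseqS rev_rcons; apply/seteqP; split => w /=.
  by move=> [-> ->].
by move=> [-> ->].
Qed.

Lemma measurable_history_eq n r : measurable [set w | history n w = r].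
Proof.
have [szr|szr] := eqVneq (size r) n; last first.
  rewrite (_ : mkset _ = set0)//; apply/seteqP; split => w //= hr.
  by move: szr; rewrite -hr size_history eqxx.
rewrite (_ : r = rev (mkseq (nth false (rev r)) n)); last first.
  by rewrite -szr -size_rev mkseq_nth revK.
rewrite history_eq; elim/big_ind : _ => //; first exact: measurableI.
by move=> i _; rewrite -[_ @^-1` _]setTI; exact: measurable_funP.
Qed.

Lemma coup_prob n b : P (X n.+1 @^-1` [set b]) = (coin p b)%:E.
Proof.
case: b => /=; first exact: (coup_win HX).
rewrite (_ : _ @^-1` _ = ~` (X n.+1 @^-1` [set true])).
  rewrite probability_setC ?(coup_win HX) //.
  by rewrite -[_ @^-1` _]setTI; exact: measurable_funP.
by apply/seteqP; split => w /=; case: (X n.+1 w).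
Qed.

Lemma history_prob n r : size r = n ->
  P [set w | history n w = r] = (weight p r)%:E.
Proof.
move=> szr; have rE : r = rev (mkseq (nth false (rev r)) n).
  by rewrite -szr -size_rev mkseq_nth revK.
rewrite rE history_eq (coup_indep HX (A := fun i => [set _])) ?iota_uniq //.
rewrite (eq_bigr (fun i => (coin p (nth false (rev r) i))%:E)); last first.
  by move=> i _; exact: coup_prob.
rewrite prodEFin /weight (perm_big (mkseq (nth false (rev r)) n)) /=.
  by rewrite big_map.
by rewrite perm_rev.
Qed.

(** A function of finitely many coups is simple; both its measurability and its integral are read
    off this expansion. *)
Lemma history_sum n (F : seq bool -> R) w :
  F (history n w) = \sum_(r <- words n) F r * \1_[set w | history n w = r] w.
Proof.
rewrite (bigD1_seq (history n w)) ?uniq_words ?mem_words ?size_history //=.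
rewrite indicE mem_set //= mulr1 big1 ?addr0// => r rh.
by rewrite indicE memNset ?mulr0//= => hr; rewrite hr eqxx in rh.
Qed.

Lemma measurable_history n (F : seq bool -> R) :
  measurable_fun setT (fun w => F (history n w)).
Proof.
rewrite (funext (history_sum n F)); apply: measurable_sum => r.
apply: measurable_funM; first exact: measurable_cst.
exact/measurable_indic/measurable_history_eq.
Qed.

Lemma integral_history n (F : seq bool -> R) : (forall r, 0 <= F r) ->
  (\int[P]_w (F (history n w))%:E = (mean p n F)%:E)%E.
Proof.
move=> F0.
under eq_integral do rewrite history_sum -sumEFin.
rewrite ge0_integral_sum//; last 2 first.
- move=> r; apply/measurable_EFinP; apply: measurable_funM => //.
  exact/measurable_indic/measurable_history_eq.
- by move=> r w _; rewrite lee_fin mulr_ge0.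
rewrite /mean -sumEFin [LHS]big_seq [RHS]big_seq; apply: eq_bigr => r.
rewrite mem_words => /eqP szr.
under eq_integral do rewrite EFinM.
rewrite ge0_integralZl_EFin//; last first.
  exact/measurable_EFinP/measurable_indic/measurable_history_eq.
rewrite integral_indic ?setIT; last 2 first.
- by [].
- exact: measurable_history_eq.
by rewrite [X in (_ * X)%E](history_prob szr) -EFinM mulrC.
Qed.

End RandomHistories.

(** * The list system as a deterministic process on words, and its supermartingales *)

Section HistoryProcess.
Variables (R : realType) (beta : seq bool -> R) (t0 : R) (l0 : nat).

(* Bets outside [0, t] and bets on an empty list are replaced by 0, so that the
   process is defined on all histories, including those that no sample point
   realizes. *)
Definition stake (s : R * nat) (x : R) : R :=
  if (0 < s.2)%N && (0 <= x <= s.1) then x else 0.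

(* At termination the target is frozen, not reset to 0. *)
Fixpoint state (r : seq bool) : R * nat :=
  if r is b :: r' then
    let s := state r' in let x := stake s (beta (rev r')) in
    (if b then s.1 - x else s.1 + x,
     if s.2 == 0%N then 0%N else if b then (s.2 - 2)%N else (s.2 + 1)%N)
  else (t0, l0).

Definition target r := (state r).1.
Definition len r := (state r).2.
Definition bet r := stake (state r) (beta (rev r)).

Fixpoint exceeded (m : R) (r : seq bool) : bool :=
  if r is _ :: r' then exceeded m r' || (m < bet r') else false.

Fixpoint total_bet (r : seq bool) : R :=
  if r is _ :: r' then total_bet r' + bet r' else 0.

(** The current length is left out, so both successors of a word get the same value; [exceeded]
    treats the current bet in the same way. *)
Fixpoint confined (G : pred nat) (r : seq bool) : bool :=
  if r is _ :: r' then confined G r' && G (len r') else true.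

Lemma target_cons b r :
  target (b :: r) = if b then target r - bet r else target r + bet r.
Proof. by []. Qed.

Lemma len_cons b r : (0 < len r)%N ->
  len (b :: r) = (if b then len r - 2 else len r + 1)%N.
Proof. by rewrite /len /= lt0n => /negbTE ->. Qed.

Hypothesis t0_ge0 : 0 <= t0.

Lemma bet_ge0 r : 0 <= bet r.
Proof. by rewrite /bet /stake; case: ifP => // /andP[_ /andP[]]. Qed.

Lemma target_ge0 r : 0 <= target r.
Proof.
elim: r => // b r IH; rewrite target_cons; case: b.
  rewrite /bet /stake -/(target r).
  by case: ifP => [/andP[_ /andP[_ ?]]|_]; rewrite subr_ge0.
by rewrite addr_ge0// bet_ge0.
Qed.

Lemma bet_le_target r : bet r <= target r.
Proof.
rewrite {1}/bet /stake; case: ifP => [/andP[_ /andP[]]//|_].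
exact: target_ge0.
Qed.

Lemma total_bet_ge0 r : 0 <= total_bet r.
Proof. by elim: r => //= _ r IH; rewrite addr_ge0// bet_ge0. Qed.

Variable p : R.

Lemma total_bet_superharmonic : 2^-1 < p ->
  superharmonic p (fun r => target r / (2 * p - 1) + total_bet r).
Proof.
move=> p2 r; rewrite !target_cons /= le_eqVlt; apply/orP; left.
have ? : 2 * p - 1 != 0 by rewrite gt_eqF//; lra.
by apply/eqP; field.
Qed.

(* For bets at most (1 - 2p) K, the function K / (K + t) of the target is a
   supermartingale; it is 1 at t = 0 and small for large t. *)
Lemma ruin_superharmonic (K : R) : p < 2^-1 -> 0 < K ->
  superharmonic p
    (fun r => if exceeded ((1 - 2 * p) * K) r then 0 else K / (K + target r)).
Proof.
move=> p2 K0 r; rewrite /=; case: (exceeded _ r) => /=.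
  by rewrite !mulr0 addr0.
have t_ge0 := target_ge0 r; have b_ge0 := bet_ge0 r; have bt := bet_le_target r.
case: ifPn => [_|]; first by rewrite !mulr0 addr0; apply: divr_ge0; lra.
rewrite -leNgt !target_cons; move: (target r) (bet r) t_ge0 b_ge0 bt => t b.
move=> t_ge0 b_ge0 bt bK.
have d1 : 0 < K + (t - b) by lra.
have d2 : 0 < K + (t + b) by lra.
have d3 : 0 < K + t by lra.
rewrite -subr_ge0.
(* The sign is that of the last factor of the numerator, nonnegative because [b <= (1 - 2 * p) * K]
   and [t >= 0]. *)
rewrite (_ : _ - _ = K * b * ((1 - 2 * p) * (K + t) - b) /
                     ((K + t) * (K + (t - b)) * (K + (t + b)))); last first.
  by field; rewrite !gt_eqF.
have p20 : 0 <= 1 - 2 * p by lra.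
apply: divr_ge0; last by rewrite !mulr_ge0// ltW.
rewrite !mulr_ge0 ?(ltW K0)// subr_ge0 (le_trans bK)// ler_wpM2l// lerDl.
by [].
Qed.

(** On [G] the Lyapunov function [g] loses at least [e] per coup in mean, which pays for the growth
    of [e * size r]; killing the process off [G] only lowers it. Hence confinement for [n] coups has
    probability at most [g l0 / (e * n)]. *)
Lemma confined_superharmonic (G : pred nat) (g : nat -> R) (e : R) :
    0 <= e -> (forall i, 0 <= g i) ->
    (forall i, G i -> (0 < i)%N /\
       p * g (i - 2)%N + (1 - p) * g (i + 1)%N + e <= g i) ->
  superharmonic p
    (fun r => if confined G r then g (len r) + e * (size r)%:R else 0).
Proof.
move=> e0 g0 gG r /=; case: (confined G r) => /=; last by rewrite !mulr0 addr0.
case: ifPn => [/gG[l_gt0 gl]|_].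
  rewrite !len_cons// -natr1.
  apply: le_trans (lerD gl (lexx _)); rewrite le_eqVlt; apply/orP; left.
  by apply/eqP; ring.
by rewrite !mulr0 addr0 addr_ge0// mulr_ge0.
Qed.

(** Length 0 is absorbing. *)
Lemma confined_pos r : (0 < len r)%N -> confined (fun i => 0 < i)%N r.
Proof.
elim: r => // b r IH /=; case: (posnP (len r)) => [l0r|r0 _].
  by rewrite {1}/len /= -/(len r) l0r.
by rewrite IH.
Qed.

End HistoryProcess.

(** * Transfer of a list system to words *)

Section ListSystemOnHistories.
Variables (d : measure_display) (Omega : measurableType d) (R : realType).
Variables (P : probability Omega R) (p : R) (X : nat -> {RV P >-> bool}).
Variables (t0 : R) (l0 : nat).
Variables (T B : nat -> Omega -> R) (l : nat -> Omega -> nat).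
Hypothesis HL : list_system (fun n w => X n w) t0 l0 T B l.

Lemma duration_le n w : l n w = 0%N -> (duration R l w <= n%:R%:E)%E.
Proof. by move=> ln0; apply: ereal_inf_lbound; exists n. Qed.

Lemma duration_gt n w : (0 < l n w)%N -> (n.+1%:R%:E <= duration R l w)%E.
Proof.
move=> ln; apply: le_ereal_inf_tmp => _ [k /= lk <-].
rewrite lee_fin ler_nat ltnNge; apply/negP => kn.
have [] := terminated HL (n := n) (w := w).
  by apply: le_trans (duration_le lk) _; rewrite lee_fin ler_nat.
by move=> _ l0n; rewrite l0n in ln.
Qed.

(** Reduces the system to functions of finite words; measurability of the bets comes from here
    too. *)
Lemma list_system_history : exists beta, forall n w,
  [/\ T n w = target beta t0 l0 (history X n w),
      l n w = len beta t0 l0 (history X n w) &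
      B n.+1 w = bet beta t0 l0 (history X n w)].
Proof.
have [beta betaE] := bet_history HL; exists beta.
have betE n w : T n w = target beta t0 l0 (history X n w) ->
    l n w = len beta t0 l0 (history X n w) ->
    B n.+1 w = bet beta t0 l0 (history X n w).
  move=> TE lE; rewrite /bet /stake -/(target _ _ _ _) -/(len _ _ _ _).
  rewrite -TE -lE rev_history -betaE (bet_range HL n w) andbT.
  case: posnP => // ln; apply: (no_bet_after HL).
  by apply: le_lt_trans (duration_le ln) _; rewrite lte_fin ltr_nat.
suff TlE n w : T n w = target beta t0 l0 (history X n w) /\
               l n w = len beta t0 l0 (history X n w).
  by move=> n w; have [TE lE] := TlE n w; split => //; exact: betE.
elim: n => [|n [TE lE]]; first by rewrite (target0E HL) (length0E HL).
have BE := betE _ _ TE lE; rewrite [history _ _ _]/= target_cons -BE -TE.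
have [ln|ln] := posnP (l n w).
  have durn := duration_le ln.
  have [Tn0 _] := terminated HL durn.
  have [|TS lS] := terminated HL (n := n.+1) (w := w).
    by apply: le_trans durn _; rewrite lee_fin ler_nat.
  have BS : B n.+1 w = 0.
    apply: (no_bet_after HL).
    by apply: le_lt_trans durn _; rewrite lte_fin ltr_nat.
  rewrite TS lS BS Tn0 addr0 subr0 if_same; split => //.
  by rewrite /len /= -/(len _ _ _ _) -lE ln.
have dn := duration_gt ln; rewrite len_cons -?lE//.
by case E : (X n.+1 w); [apply: (coup_won HL)|apply: (coup_lost HL)].
Qed.

Variable beta : seq bool -> R.
Local Notation target := (target beta t0 l0).
Local Notation len := (len beta t0 l0).
Local Notation bet := (bet beta t0 l0).
Local Notation exceeded := (exceeded beta t0 l0).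
Local Notation total_bet := (total_bet beta t0 l0).
Local Notation confined := (confined beta t0 l0).

Hypothesis TlBE : forall n w, [/\ T n w = target (history X n w),
  l n w = len (history X n w) & B n.+1 w = bet (history X n w)].

Let t0_gt0 : 0 < t0 := target0_gt0 HL.
Let t0_ge0 : 0 <= t0 := ltW t0_gt0.

(** Trades the random range of coups for all [n], giving a countable supremum of measurable
    functions. *)
Lemma largest_betE w :
  largest_bet B l w = esups (fun n => (bet (history X n w))%:E) 0%N.
Proof.
apply/eqP; rewrite eq_le; apply/andP; split.
  apply: ge_ereal_sup => _ [[|n] /= [n1 _] <-]; first by [].
  apply: ereal_sup_ubound.
  by exists n => //; have [_ _ ->] := TlBE n w.
apply: ge_ereal_sup => _ [n /= _ <-]; have [_ lE BE] := TlBE n w.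
have [ln|ln] := posnP (l n w); last first.
  apply: ereal_sup_ubound; exists n.+1; rewrite ?BE//=; split => //.
  exact: duration_gt.
(* After termination the bet on words is 0, hence at most the first bet, which always counts since
   [l0 > 0]. *)
apply: (@le_trans _ _ (B 1 w)%:E).
  rewrite /bet /stake -/(len _) -lE ln /= lee_fin.
  by have /andP[] := bet_range HL 0 w.
apply: ereal_sup_ubound; exists 1%N => //=; split => //.
by apply: duration_gt; rewrite (length0E HL) (length0_gt0 HL).
Qed.

Lemma le_largest_bet n w : ((bet (history X n w))%:E <= largest_bet B l w)%E.
Proof. by rewrite largest_betE; apply: ereal_sup_ubound; exists n. Qed.

Lemma largest_bet_ge0 w : (0 <= largest_bet B l w)%E.
Proof. by apply: le_trans (le_largest_bet 0 w); rewrite lee_fin bet_ge0. Qed.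

Lemma measurable_largest_bet : measurable_fun setT (largest_bet B l).
Proof.
rewrite (funext largest_betE); apply: measurable_fun_esups => n.
exact/measurable_EFinP/measurable_history.
Qed.

Lemma exceeded_lt_largest_bet m n w :
  exceeded m (history X n w) -> (m%:E < largest_bet B l w)%E.
Proof.
elim: n => //= n IH /orP[/IH//|mb].
by apply: lt_le_trans (le_largest_bet n w); rewrite lte_fin.
Qed.

(** A layer-cake bound: if the top threshold [K] is exceeded, the largest bet is above [K], while
    the sum has only [K] terms, each at most 1. *)
Lemma sum_exceeded_le n K w :
  ((\sum_(k < K) (exceeded k.+1%:R (history X n w))%:R)%:E
    <= largest_bet B l w)%E.
Proof.
elim: K => [|K IH]; first by rewrite big_ord0 largest_bet_ge0.
rewrite big_ord_recr /=; case E : (exceeded K.+1%:R _); last by rewrite addr0.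
apply: ltW; apply: le_lt_trans (exceeded_lt_largest_bet E); rewrite lee_fin.
rewrite -natr1 lerD2r; apply: le_trans (_ : \sum_(k < K) 1 <= _).
  by apply: ler_sum => k _; rewrite lern1 leq_b1.
by rewrite sumr_const card_ord.
Qed.

(** * Bounds on the expected largest bet *)

Hypotheses (p01 : 0 <= p <= 1) (HX : independent_coups p X).

Lemma mean_total_bet_le n : 2^-1 < p ->
  mean p n total_bet <= t0 / (2 * p - 1).
Proof.
move=> p2.
have := mean_superharmonic p01 n (total_bet_superharmonic beta t0 l0 p2).
rewrite /= addr0; apply: le_trans; apply: (ler_mean p01) => r.
by rewrite lerDr divr_ge0 ?target_ge0//; lra.
Qed.

(** The running totals increase and dominate each bet, so monotone convergence carries their uniform
    mean bound over to the largest bet. *)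
Lemma integral_largest_bet_lty : 2^-1 < p ->
  (\int[P]_w largest_bet B l w < +oo)%E.
Proof.
move=> p2; set S := fun n w => (total_bet (history X n w))%:E.
have nd w : nondecreasing_seq (S ^~ w).
  by apply/nondecreasing_seqP => n; rewrite lee_fin /= lerDl bet_ge0.
have mS n : measurable_fun setT (S n).
  exact/measurable_EFinP/measurable_history.
have S0 n w : setT w -> (0 <= S n w)%E by rewrite lee_fin total_bet_ge0.
apply: (@le_lt_trans _ _ (\int[P]_w limn (S ^~ w))%E).
  apply: ge0_le_integral => //.
  - by move=> w _; exact: largest_bet_ge0.
  - exact: measurable_largest_bet.
  - apply: (emeasurable_fun_cvg S) => // w _.
    exact: ereal_nondecreasing_is_cvgn.
  move=> w _; rewrite largest_betE; apply: ge_ereal_sup => _ [n /= _ <-].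
  apply: lime_ge; first exact: ereal_nondecreasing_is_cvgn.
  exists n.+1 => // m /= nm; apply: le_trans (nd w _ _ nm).
  by rewrite lee_fin /= lerDr total_bet_ge0.
rewrite monotone_convergence//.
apply: (@le_lt_trans _ _ (t0 / (2 * p - 1))%:E); last by rewrite ltry.
apply: lime_le.
  apply: ereal_nondecreasing_is_cvgn => m n mn.
  by apply: ge0_le_integral => // [w _|w _]; [exact: S0|exact: nd].
apply: nearW => n; rewrite /S (integral_history HX) ?lee_fin.
  exact: mean_total_bet_le.
by move=> r; exact: total_bet_ge0.
Qed.

(* A history either contains a bet above m, or ends with target 0, or has not
   terminated; the last two are controlled by the two supermartingales. *)
Lemma mean_exceeded_ge (G : pred nat) (g : nat -> R) (e m : R) :
    p < 2^-1 -> 0 < m -> 0 < e -> (forall i, 0 <= g i) ->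
    (forall i, G i -> (0 < i)%N /\
       p * g (i - 2)%N + (1 - p) * g (i + 1)%N + e <= g i) ->
    {ae P, forall w, forall n, (0 < l n w)%N ->
       ~~ exceeded m (history X n w) -> confined G (history X n w)} ->
  forall n, t0 * (1 - 2 * p) / (m + t0 * (1 - 2 * p)) - g l0 / e / n.+1%:R <=
    mean p n.+1 (fun r => (exceeded m r)%:R).
Proof.
move=> p2 m0 e0 g0 gG aeG n.
have q0 : 0 < 1 - 2 * p by lra.
set K := m / (1 - 2 * p); have K0 : 0 < K by rewrite divr_gt0.
have mK : (1 - 2 * p) * K = m by rewrite mulrC divfK// gt_eqF.
have := ruin_superharmonic beta l0 t0_ge0 p2 K0; rewrite mK.
set u := (X in superharmonic _ X) => /(mean_superharmonic p01 n.+1) u_le.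
have := confined_superharmonic beta t0 l0 (ltW e0) g0 gG.
set v := (X in superharmonic _ X) => /(mean_superharmonic p01 n.+1) v_le.
have u0 r : 0 <= u r.
  rewrite /u; case: ifP => // _.
  by rewrite divr_ge0 ?addr_ge0 ?(ltW K0)// target_ge0.
have v0 r : 0 <= v r.
  by rewrite /v; case: ifP => // _; rewrite addr_ge0// mulr_ge0// ltW.
have en0 : 0 < e * n.+1%:R by rewrite mulr_gt0.
(* Almost surely [F] is at least 1 on the history: each of the three cases makes one summand at
   least 1. *)
pose F r := (exceeded m r)%:R + u r + v r * (e * n.+1%:R)^-1.
have F0 r : 0 <= F r by rewrite !addr_ge0// divr_ge0// ltW.
have : (1 <= (mean p n.+1 F)%:E)%E.
  rewrite -(integral_history HX)//.
  rewrite -[leLHS](probability_setT P) -[leLHS]mul1e -integral_cst//.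
  apply: ae_ge0_le_integral => //.
  - by move=> w _; rewrite lee_fin.
  - exact/measurable_EFinP/measurable_history.
  apply: filterS aeG => w Gw _; rewrite /= lee_fin /F /u.
  case: ifPn => [_|nex].
    by rewrite addr0 lerDl divr_ge0// ltW.
  rewrite add0r; have [ln|ln] := posnP (l n.+1 w).
    have [Tn _] := terminated HL (duration_le ln).
    have [<- _ _] := TlBE n.+1 w; rewrite Tn addr0 divff ?gt_eqF//.
    by rewrite lerDl divr_ge0// ltW.
  apply: (@le_trans _ _ (v (history X n.+1 w) / (e * n.+1%:R))); last first.
    by rewrite lerDr divr_ge0 ?addr_ge0 ?(ltW K0)// target_ge0.
  rewrite /v Gw// size_history ler_pdivlMr// mul1r lerDr.
  exact: g0.
rewrite lee_fin !meanD meanZr /u /v; rewrite /u /v /= mulr0 addr0 in u_le v_le.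
set E := mean _ _ _; set U := mean _ _ _ in u_le *.
have {}u_le : U <= K / (K + t0) by [].
set V := mean _ _ _ in v_le * => H.
have VE : V / (e * n.+1%:R) <= g l0 / e / n.+1%:R.
  by rewrite -mulrA -invfM ler_wpM2r// invr_ge0 ltW.
have : t0 * (1 - 2 * p) / (m + t0 * (1 - 2 * p)) = 1 - K / (K + t0).
  have ? : 0 < t0 * (1 - 2 * p) by rewrite mulr_gt0.
  by rewrite /K; field; apply/andP; split; rewrite gt_eqF//; lra.
move=> ->; rewrite lerBlDr lerBlDr; apply: le_trans H _.
by rewrite addrAC; apply: lerD u_le; apply: lerD VE.
Qed.

Lemma integral_largest_bet_y : p < 2^-1 ->
    (forall m, 0 < m -> exists C, forall n,
       t0 * (1 - 2 * p) / (m + t0 * (1 - 2 * p)) - C / n.+1%:R <=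
       mean p n.+1 (fun r => (exceeded m r)%:R)) ->
  (\int[P]_w largest_bet B l w = +oo)%E.
Proof.
move=> p2 HC; set s := t0 * (1 - 2 * p) in HC.
have s0 : 0 < s by rewrite mulr_gt0//; lra.
have a0 k : 0 < s / (k.+1%:R + s) by rewrite divr_gt0// addr_gt0.
(* For a fixed threshold the error [C / n.+1%:R] eventually drops below half of the main term. *)
have /choice[N NP] (k : nat) : exists N, forall n, (N <= n)%N ->
    s / (k.+1%:R + s) / 2 <= mean p n.+1 (fun r => (exceeded k.+1%:R r)%:R).
  have [C HCk] := HC k.+1%:R (ltr0Sn _ _).
  exists (Num.bound `|C / (s / (k.+1%:R + s) / 2)|) => n Nn.
  apply: le_trans (HCk n).
  have : C / n.+1%:R <= s / (k.+1%:R + s) / 2.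
    rewrite ler_pdivrMr// [leRHS]mulrC.
    rewrite -ler_pdivrMr; last by rewrite divr_gt0 ?a0.
    apply: le_trans (ler_norm _) _.
    apply: le_trans (ltW (archi_boundP (normr_ge0 _))) _.
    by rewrite ler_nat leqW.
  by move=> Ca; rewrite lerBrDr [leRHS]splitr lerD2l.
(* From [k.+1 + s <= k.+1 * (1 + s)], the halved main term is at least [c / k.+1]. *)
set c := s / (1 + s) / 2; have c0 : 0 < c by rewrite !divr_gt0// addr_gt0.
have lb K : ((c * series harmonic K)%:E <= \int[P]_w largest_bet B l w)%E.
  (* [N k] depends on the threshold; finitely many thresholds share this horizon. *)
  set n := (\max_(k < K) N k)%N.
  apply: (@le_trans _ _
    (\int[P]_w (\sum_(k < K) (exceeded k.+1%:R (history X n.+1 w))%:R)%:E)%E);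
    last first.
    apply: ge0_le_integral => //.
    - by move=> w _; rewrite lee_fin sumr_ge0.
    - apply/measurable_EFinP/(measurable_history X n.+1
        (fun r => \sum_(k < K) (exceeded k.+1%:R r)%:R)).
    - exact: measurable_largest_bet.
    - by move=> w _; exact: sum_exceeded_le.
  rewrite (integral_history HX n.+1
    (F := fun r => \sum_(k < K) (exceeded k.+1%:R r)%:R)); last first.
    by move=> r; rewrite sumr_ge0.
  rewrite lee_fin mean_sum /series /= big_mkord mulr_sumr ler_sum// => k _.
  have Nk : (N k <= n)%N by exact: (leq_bigmax (F := fun k : 'I_K => N k)).
  apply: le_trans (NP k n Nk).
  rewrite /c mulrAC ler_pM2r// -mulrA ler_pM2l// /harmonic -invfM lef_pV2.
  - by rewrite mulrDl mul1r lerD2l ler_peMr ?(ltW s0)// ler1n.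
  - by rewrite posrE mulr_gt0// addr_gt0.
  - by rewrite posrE addr_gt0.
apply/eqyP => A A0.
have nd : nondecreasing_seq (series (@harmonic R)).
  by apply/nondecreasing_seqP => n; rewrite seriesSr lerDl harmonic_ge0.
have /cvgryPge/(_ (A / c))[n _ /(_ n (leqnn n))] :=
  nondecreasing_dvgn_lt nd (@dvg_harmonic R).
rewrite /= ler_pdivrMr// mulrC => An.
by apply: le_trans (lb n); rewrite lee_fin.
Qed.

Lemma negative_drift_largest_bet : 3^-1 < p < 2^-1 ->
  (\int[P]_w largest_bet B l w = +oo)%E.
Proof.
move=> /andP[p3 p2]; apply: integral_largest_bet_y => // m m0.
(* The extra unit drop at 0 compensates truncation: at length 1 a win shortens the list by only 1,
   and the plain length would not decrease enough in mean. *)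
pose g i : R := if i == 0 then 0 else i.+1%:R.
exists (g l0 / (3 * p - 1)).
apply: (mean_exceeded_ge (G := fun i => (0 < i)%N) (g := g)) => //.
- by lra.
- by move=> i; rewrite /g; case: ifP.
- move=> [|[|[|i]]] // _; split => //; rewrite /g /= ?subnn /=.
  + by lra.
  + by lra.
  + rewrite subn2 addn1 /= -!natr1; lra.
- apply: aeW => w n; have [_ -> _] := TlBE n w => ln _; exact: confined_pos.
Qed.

Lemma growing_bets_largest_bet (c1 c2 : R) : p <= 3^-1 -> 0 < c1 ->
    {ae P, forall w, forall n, (n.+1%:R%:E <= duration R l w)%E ->
       c1 * (l n w)%:R + c2 <= B n.+1 w} ->
  (\int[P]_w largest_bet B l w = +oo)%E.
Proof.
move=> p3 c10 aeB; have p2 : p < 2^-1 by lra.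
apply: integral_largest_bet_y => // m m0.
(* A bet at most [m] forces [c1 * l + c2 <= m], hence a length below [L]. *)
set L := Num.bound `|(m - c2) / c1|.
(* For [i >= 2] the squared length has drift [2 * i * (1 - 3 * p) + 1 + 3 * p >= 1]. Using [L.+1]
   keeps the truncated subtraction exact after a loss at length [L]. *)
pose g i : R := (L.+1 ^ 2 - i ^ 2)%N%:R.
pose G i := (0 < i <= L)%N.
exists (g l0 / 1); apply: (mean_exceeded_ge (G := G) (g := g) (e := 1)) => //.
- have gE j : (j <= L.+1)%N -> g j = L.+1%:R ^+ 2 - j%:R ^+ 2.
    by move=> jL; rewrite /g natrB ?leq_sqr// !natrX.
  move=> i /andP[i0 iL]; split=> //; rewrite !gE; [|lia..].
  move: (L.+1%:R ^+ 2) => M; move: p01 => /andP[p0 _]; rewrite addn1.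
  case: i i0 iL => [|[|i]] // _ _; first by rewrite -[(1 - 2)%N]/0%N; lra.
  have i0 : 0 <= i%:R :> R by [].
  by rewrite subn2 /= -!natr1; nra.
- apply: filterS aeB => w Bw; elim => [|n IH] // ln /=.
  rewrite negb_or => /andP[nex nm].
  have ln0 : (0 < l n w)%N.
    rewrite lt0n; apply/eqP => l0n; move: ln.
    have [] := terminated HL (n := n.+1) (w := w); last by move=> _ ->.
    by apply: le_trans (duration_le l0n) _; rewrite lee_fin ler_nat.
  rewrite IH// /G; have := Bw n (duration_gt ln0); have [_ <- ->] := TlBE n w.
  rewrite ln0 /= => H; rewrite -(ler_nat R).
  apply: ltW; apply: le_lt_trans (archi_boundP (normr_ge0 _)).
  apply: le_trans (ler_norm _); rewrite ler_pdivlMr// mulrC lerBrDr.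
  by rewrite (le_trans H)// leNgt.
Qed.

End ListSystemOnHistories.

Theorem theorem1 (d : measure_display) (Omega : measurableType d)
    (R : realType) (P : probability Omega R)
    (p : R) (p01 : 0 <= p <= 1)
    (X : nat -> {RV P >-> bool}) (HX : independent_coups p X)
    (t0 : R) (l0 : nat) (T B : nat -> Omega -> R) (l : nat -> Omega -> nat)
    (HL : list_system (fun n w => X n w) t0 l0 T B l) :
  [/\ 2^-1 < p -> (\int[P]_w largest_bet B l w < +oo)%E,
      3^-1 < p < 2^-1 -> (\int[P]_w largest_bet B l w = +oo)%E
    & p <= 3^-1 -> forall c1 c2 : R, 0 < c1 ->
      {ae P, forall w, forall n, ((n.+1%:R)%:E <= duration R l w)%E ->
        c1 * (l n w)%:R + c2 <= B n.+1 w} ->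
      (\int[P]_w largest_bet B l w = +oo)%E].

Proof.
have [beta TlBE] := list_system_history HL.
split => [p2|p32|p3 c1 c2 c10 aeB].
- exact: (integral_largest_bet_lty HL TlBE p01 HX p2).
- exact: (negative_drift_largest_bet HL TlBE p01 HX p32).
- exact: (growing_bets_largest_bet HL TlBE p01 HX p3 c10 aeB).
Qed.
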